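(* Let $G=(V,E)$ be a hypergraph and let $(V_1,\dots,V_k)$ be a maximal minimum $k$-partition in $G$ for an integer $k\ge 2$. Suppose $|V_1|\ge 2k-2$. Then for every subset $T\subseteq V\setminus V_1$ such that $T\cap V_j\neq\emptyset$ for every $j\in\{2,\dots,k\}$, there exists a subset $S\subseteq V_1$ with $|S|=2k-2$ such that $(V_1,V\setminus V_1)$ is the source maximal minimum $(S,T)$-terminal cut.
   Context: A hypergraph $G=(V,E)$ has a finite vertex set $V$ and a finite multiset $E$ of hyperedges (subsets of $V$); all hyperedges have unit cost. For $U\subseteq V$, $\overline{U}=V\setminus U$, and $d(U)$ is the number of hyperedges intersecting both $U$ and $\overline{U}$. For a partition $(P_1,\dots,P_h)$ of $V$ into non-empty sets (ordered tuple), $\mathrm{cost}(P_1,\dots,P_h)$ is the number of hyperedges intersecting at least two parts. A minimum $k$-partition is a $k$-partition of minimum cost. A minimum $k$-partition $(V_1,\dots,V_k)$ is a maximal minimum $k$-partition if there is no other minimum $k$-partition $(V_1',\dots,V_k')$ with $V_1\subsetneq V_1'$. For disjoint $S,T\subseteq V$, a 2-partition $(U,\overline{U})$ is an $(S,T)$-terminal cut if $S\subseteq U\subseteq V\setminus T$; it is a minimum $(S,T)$-terminal cut if $d(U)$ is minimum among all $(S,T)$-terminal cuts; the source maximal minimum $(S,T)$-terminal cut is the (unique) minimum $(S,T)$-terminal cut whose source set $U$ is inclusion-wise maximal. *)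

(* Defs.v *)
From mathcomp Require Import all_boot.
Set Implicit Arguments. Unset Strict Implicit. Unset Printing Implicit Defensive.

(* A hypergraph on a finite vertex type V is a multiset (seq) of hyperedges
   E : seq {set V}; all hyperedges have unit cost. *)
Section Hyper.
Variable V : finType.
Variable E : seq {set V}.

Definition dcut (U : {set V}) : nat :=
  count (fun e => (e :&: U != set0) && (e :&: ~: U != set0)) E.

Definition is_partition (P : seq {set V}) : Prop :=
  [/\ all (fun A => A != set0) P,
      (forall i j, i < j -> j < size P ->
         [disjoint nth set0 P i & nth set0 P j])
    & \bigcup_(A <- P) A = [set: V]].

Definition is_kpartition (k : nat) (P : seq {set V}) : Prop :=
  size P = k /\ is_partition P.

Definition pcost (P : seq {set V}) : nat :=
  count (fun e => 1 < count (fun A => e :&: A != set0) P) E.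

Definition is_min_kpartition (k : nat) (P : seq {set V}) : Prop :=
  is_kpartition k P /\
  (forall Q, is_kpartition k Q -> pcost P <= pcost Q).

(* V_1 is the first part, nth set0 P 0 *)
Definition is_maximal_min_kpartition (k : nat) (P : seq {set V}) : Prop :=
  is_min_kpartition k P /\
  ~ (exists Q, is_min_kpartition k Q /\ nth set0 P 0 \proper nth set0 Q 0).

(* (U, ~U) is an (S,T)-terminal cut *)
Definition is_terminal_cut (S T U : {set V}) : Prop :=
  S \subset U /\ U \subset ~: T.

Definition is_min_terminal_cut (S T U : {set V}) : Prop :=
  is_terminal_cut S T U /\
  (forall U', is_terminal_cut S T U' -> dcut U <= dcut U').

Definition is_source_maximal_min_terminal_cut (S T U : {set V}) : Prop :=
  is_min_terminal_cut S T U /\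
  ~ (exists U', is_min_terminal_cut S T U' /\ U \proper U').

End Hyper.

(* Main.v *)
Require Import Defs.
From mathcomp Require Import all_boot.
From mathcomp Require Import zify.

Set Implicit Arguments.
Unset Strict Implicit.
Unset Printing Implicit Defensive.

(** Let [U] be the first part and let [S] be inclusion-wise minimal among the
sources for which [U] is the source maximal minimum cut.  The set [U] itself is
such a source: any larger [X] disjoint from [T] can absorb vertices of the other
parts without emptying them, so maximality of the partition gives [d(U) < d(X)].
It suffices to show that [S] has fewer than [2k - 2] elements, since enlarging
[S] inside [U] is harmless.

By minimality of [S] and uncrossing with [U], each [u] in [S] has a set [A_u]
with [d(A_u) < d(U)] that contains the complement of [U] and meets [S] in [u]
only.  Let [L_j] be the set of vertices covered more than [j] times by the
[A_u].  Then [sum_j d(L_j) <= sum_u d(A_u)], and for [1 <= j < |S|] the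
complement of [L_j] lies between [S] and [U], so [d(L_j) >= d(U)].  Hence
[sum_u d(A_u)] minus the contribution of [L_2, L_3, ...] is less than [2 d(U)].
This difference bounds the total cost of two [k]-partitions, each made of
[k - 1] of the sets [A_u] minus [L_1] and a remainder, for disjoint choices of
indices [u]; such choices exist if [|S| >= 2k - 2].  One of the two partitions
would then cost less than [d(U)], which is at most the cost of the given
partition. *)

Lemma count_sum_nat (T : Type) (a : pred T) (s : seq T) :
  count a s = \sum_(x <- s) a x.
Proof. by rewrite -sumn_count sumnE big_map. Qed.

Lemma sum_nat_pred_card (I : finType) (S : {set I}) (a : pred I) :
  \sum_(i in S) a i = #|[set i in S | a i]|.
Proof.
by rewrite -sum1dep_card big_mkcondr; apply: eq_bigr => i _; case: (a i).
Qed.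

Lemma exists_set_between (I : finType) (A B : {set I}) m :
  A \subset B -> #|A| <= m <= #|B| ->
  exists C : {set I}, [/\ A \subset C, C \subset B & #|C| = m].
Proof.
move=> sAB /andP[leAm lemB].
have /card_geqP[s [uniq_s size_s sub_s]] : m - #|A| <= #|B :\: A|.
  by rewrite cardsDS // leq_sub2r.
exists (A :|: [set x in s]); split.
- exact: subsetUl.
- by rewrite subUset sAB; apply/subsetP=> x; rewrite inE => /sub_s /setDP[].
- have disjAs : A :&: [set x in s] = set0.
    apply/setP=> x; rewrite !inE; apply/negbTE/negP => /andP[xA /sub_s].
    by rewrite inE xA.
  rewrite cardsU disjAs cards0 subn0 cardsE (card_uniqP uniq_s) size_s.
  by rewrite subnKC.
Qed.

Section Hypergraph.
Variable V : finType.
Implicit Types (x : V) (e A B U X S T : {set V}) (P E : seq {set V}).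

Definition crosses e U : bool := (e :&: U != set0) && (e :&: ~: U != set0).

Lemma crossesP e U :
  reflect (exists x y, [/\ x \in e, x \in U, y \in e & y \notin U])
          (crosses e U).
Proof.
apply: (iffP andP) => [[/set0Pn[x /setIP[xe xU]] /set0Pn[y /setIP[ye]]]|].
  by rewrite inE => yU; exists x, y.
case=> x [y [xe xU ye yU]].
by split; apply/set0Pn; [exists x | exists y]; rewrite !inE ?xe ?ye.
Qed.

Lemma dcutE E U : dcut E U = \sum_(e <- E) crosses e U.
Proof. exact: count_sum_nat. Qed.

Lemma dcutC E U : dcut E (~: U) = dcut E U.
Proof. by apply: eq_count => e; rewrite setCK andbC. Qed.

Lemma crosses_submod e A B :
  crosses e (A :&: B) + crosses e (A :|: B) <= crosses e A + crosses e B.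
Proof.
have meetS (X Y : {set V}) : X \subset Y ->
    (e :&: X != set0) ==> (e :&: Y != set0).
  by move=> sXY; apply/implyP/subset_neq0/setIS.
rewrite /crosses setCI setCU !(setIUr e) !setU_eq0 !negb_and.
have := meetS _ _ (subsetIl A B); have := meetS _ _ (subsetIr A B).
have := meetS _ _ (subsetIl (~: A) (~: B)).
have := meetS _ _ (subsetIr (~: A) (~: B)).
by do 6!case: (_ != _).
Qed.

Lemma dcut_submod E A B :
  dcut E (A :&: B) + dcut E (A :|: B) <= dcut E A + dcut E B.
Proof.
by rewrite !dcutE -!big_split; apply: leq_sum => e _; apply: crosses_submod.
Qed.

Lemma is_partitionP P :
  reflect (is_partition P)
    [&& all (fun A => A != set0) P, pairwise (fun A B => [disjoint A & B]) P
      & \bigcup_(A <- P) A == setT].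
Proof.
apply: (iffP and3P) => [[neP /(pairwiseP set0) disjP /eqP covP]|].
  by split=> // i j ltij ltj; apply: disjP => //; apply: ltn_trans ltj.
case=> neP disjP covP; split=> //; last exact/eqP.
by apply/(pairwiseP set0) => i j _ ltj ltij; apply: disjP.
Qed.

Lemma is_partition_cover P x : is_partition P -> exists2 A, A \in P & x \in A.
Proof.
case=> _ _ covP; have : x \in \bigcup_(A <- P) A by rewrite covP.
by rewrite bigcup_seq => /bigcupP.
Qed.

Lemma splits_partition P e : is_partition P ->
  (1 < count (fun A => e :&: A != set0) P) = has (crosses e) P.
Proof.
move=> partP; apply/idP/idP=> [|/hasP[A AP /crossesP[x [y [xe xA ye yA]]]]].
- apply: contraLR => /hasPn ncross; rewrite -size_filter -leqNgt.
  have /is_partitionP/and3P[_ disjP _] := partP.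
  have meet_sub A : A \in [seq A <- P | e :&: A != set0] ->
      e != set0 /\ e \subset A.
    rewrite mem_filter => /andP[eA /ncross].
    rewrite negb_and eA negbK /= -setDE setD_eq0; split=> //.
    by apply: contraNneq eA => ->; rewrite set0I.
  have := pairwise_filter (fun A => e :&: A != set0) disjP.
  case: filter meet_sub => [|A [|B Q]] //= meet_sub /andP[/andP[disjAB _] _].
  have [/set0Pn[x xe] /subsetP/(_ x xe) xA] := meet_sub A (mem_head _ _).
  have [|_ /subsetP/(_ x xe) xB] := meet_sub B; first by rewrite !inE eqxx orbT.
  by rewrite (disjointFr disjAB xA) in xB.
- have [B BP yB] := is_partition_cover y partP.
  rewrite -size_filter; apply: leq_trans (card_size _); apply/card_gt1P.
  exists A, B; rewrite !mem_filter AP BP !andbT; split.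
  + by apply/set0Pn; exists x; apply/setIP.
  + by apply/set0Pn; exists y; apply/setIP.
  + by apply: contraNneq yA => ->.
Qed.

Lemma pcost_partition E P : is_partition P ->
  pcost E P = count (fun e => has (crosses e) P) E.
Proof. by move=> partP; apply: eq_count => e; apply: splits_partition. Qed.

Lemma dcut_le_pcost E P A : is_partition P -> A \in P -> dcut E A <= pcost E P.
Proof.
move=> partP AP; rewrite pcost_partition //.
by apply: sub_count => e eA; apply/hasP; exists A.
Qed.

Lemma crosses_head_partition A P e : is_partition (A :: P) ->
  crosses e A -> has (crosses e) P.
Proof.
move=> partAP /crossesP[x [y [xe xA ye yA]]].
have /is_partitionP/and3P[_ /= /andP[/allP disjA _] _] := partAP.
have [B] := is_partition_cover y partAP; rewrite inE => /predU1P[->|BP yB].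
  by rewrite (negPf yA).
apply/hasP; exists B => //; apply/crossesP; exists y, x; split=> //.
by rewrite (disjointFr (disjA _ BP)).
Qed.

Lemma pcost_partition_cons E A P : is_partition (A :: P) ->
  pcost E (A :: P) = count (fun e => has (crosses e) P) E.
Proof.
move=> partAP; rewrite pcost_partition //; apply: eq_count => e /=.
by apply/orb_idl/crosses_head_partition.
Qed.

Definition absorb X P : seq {set V} := X :: [seq B :\: X | B <- P].

Lemma absorb_partition A P X : is_partition (A :: P) ->
  A \subset X -> {in P, forall B, B :\: X != set0} ->
  is_partition (absorb X P).
Proof.
move=> partAP sAX neDX.
have /is_partitionP/and3P[/= /andP[neA _] /andP[_ disjP] _] := partAP.
apply/is_partitionP/and3P; split=> /=.
- by rewrite (subset_neq0 sAX neA) all_map; apply/allP.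
- rewrite all_map pairwise_map; apply/andP; split.
    by apply/allP=> B _ /=; rewrite disjoint_sym disjoints_subset subsetDr.
  apply: sub_pairwise disjP => B C /= disjBC.
  exact: disjointW (subsetDl _ _) (subsetDl _ _) disjBC.
- rewrite big_cons big_map bigcup_seq -subTset; apply/subsetP=> x _.
  rewrite inE; have [//|xX] /= := boolP (x \in X).
  have [B] := is_partition_cover x partAP; rewrite inE => /predU1P[-> xA|BP xB].
    by rewrite (subsetP sAX) in xX.
  by apply/bigcupP; exists B => //; rewrite inE xX.
Qed.

Lemma pcost_absorb E A P X : is_partition (A :: P) ->
  A \subset X -> {in P, forall B, B :\: X != set0} ->
  pcost E (absorb X P) + dcut E A <= pcost E (A :: P) + dcut E X.
Proof.
move=> partAP sAX neDX; have partX := absorb_partition partAP sAX neDX.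
rewrite !pcost_partition_cons //.
rewrite !count_sum_nat !dcutE -!big_split /=; apply: leq_sum => e _.
have le_head : crosses e A <= has (crosses e) P.
  by have := @crosses_head_partition _ _ e partAP; case: crosses => // ->.
have [eX | neX] := boolP (crosses e X); first by rewrite addnC leq_add ?leq_b1.
rewrite addn0; have [|_] := boolP (has _ _); last by rewrite add0n.
case/hasP=> _ /mapP[B BP ->] /crossesP[x [y [xe /setDP[xB xX] ye yBX]]].
have notX z : z \in e -> z \notin X.
  by move=> ze; apply: contra neX => zX; apply/crossesP; exists z, x.
have -> : has (crosses e) P.
  apply/hasP; exists B => //; apply/crossesP; exists x, y; split=> //.
  by apply: contra yBX => yB; rewrite inE notX.
have -> // : crosses e A = false.
by apply/crossesP => -[z [t [/notX zX /(subsetP sAX)]]]; rewrite (negPf zX).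
Qed.

Lemma maximal_min_kpartition_dcut_lt E k A P X :
  is_maximal_min_kpartition E k (A :: P) ->
  A \proper X -> {in P, forall B, B :\: X != set0} -> dcut E A < dcut E X.
Proof.
case=> [[[sizeP partP] minP] maxP] prAX neDX; have sAX := proper_sub prAX.
rewrite ltnNge; apply/negP => le_dcut; apply: maxP; exists (absorb X P).
split=> //; split.
  by split; [rewrite -sizeP /= size_map | apply: absorb_partition sAX neDX].
move=> Q kQ; apply: leq_trans (minP Q kQ).
by have := pcost_absorb E partP sAX neDX; lia.
Qed.

Section Remainder.
Variables (I : finType) (F : I -> {set V}) (J : {set I}).

Definition add_remainder : seq {set V} :=
  ~: (\bigcup_(i in J) F i) :: [seq F i | i in J].

Lemma add_remainder_kpartition :
  {in J, forall i, F i != set0} ->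
  {in J &, forall i j, i != j -> [disjoint F i & F j]} ->
  \bigcup_(i in J) F i != setT ->
  is_kpartition #|J|.+1 add_remainder.
Proof.
move=> neF disjF neT; split; first by rewrite /= size_image.
apply/is_partitionP/and3P; split=> /=.
- rewrite -(inj_eq (@setC_inj V)) setCK setC0 neT.
  by apply/allP=> _ /imageP[i iJ ->]; apply: neF.
- apply/andP; split.
    apply/allP=> _ /imageP[i iJ ->].
    by rewrite disjoint_sym disjoints_subset setCK bigcup_sup.
  rewrite pairwise_map; have := enum_uniq J; rewrite uniq_pairwise.
  apply: (sub_in_pairwise (P := mem J)) => [i j iJ jJ /=|]; first exact: disjF.
  by apply/allP=> i; rewrite mem_enum.
- by rewrite big_cons big_image setUC setUCr.
Qed.

Lemma pcost_add_remainder E : is_partition add_remainder ->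
  pcost E add_remainder = count (fun e => [exists i in J, crosses e (F i)]) E.
Proof.
move=> partF; rewrite pcost_partition_cons //; apply: eq_count => e.
apply/hasP/exists_inP => [[_ /imageP[i iJ ->] ei]|[i iJ ei]]; first by exists i.
by exists (F i); rewrite ?image_f.
Qed.

End Remainder.

Section Levels.
Variables (I : finType) (A : I -> {set V}) (S : {set I}).
Implicit Types (i : I) (J K : {set I}).

Definition depth x : nat := #|[set i in S | x \in A i]|.

Definition level n : {set V} := [set x | n < depth x].

Lemma subset_level n B : {in S, forall i, B \subset A i} -> n < #|S| ->
  B \subset level n.
Proof.
move=> sBA ltnS; apply/subsetP=> x xB; rewrite inE /depth.
rewrite (_ : [set i in S | x \in A i] = S) //; apply/setP=> i; rewrite inE.
by apply: andb_idr => /sBA/subsetP; apply.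
Qed.

Definition private i : {set V} := A i :\: level 1.

Lemma privateP i x : i \in S ->
  reflect ([set j in S | x \in A j] = [set i]) (x \in private i).
Proof.
move=> iS; rewrite !inE -leqNgt; apply: (iffP andP) => [[le1 xi]|eq1].
  apply/esym/eqP; rewrite eqEcard cards1 le1 andbT sub1set.
  by rewrite inE iS.
rewrite /depth eq1 cards1; split=> //.
by have /setP/(_ i) := eq1; rewrite !inE eqxx iS.
Qed.

Lemma private_disjoint : {in S &, forall i j, i != j ->
  [disjoint private i & private j]}.
Proof.
move=> i j iS jS neq; apply/pred0P=> x; apply/negP => /andP[].
move=> /(privateP _ iS) eqi /(privateP _ jS); rewrite eqi => /setP/(_ i).
by rewrite !inE eqxx (negPf neq).
Qed.

Lemma sum_crosses_level_le_range e a b m n :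
  {in e, forall x, a <= depth x <= b} ->
  \sum_(m <= j < n) crosses e (level j) <= b - maxn a m.
Proof.
move=> depth_e; rewrite -(count_sum_nat (fun j => crosses e (level j))).
rewrite -size_filter -(size_iota (maxn a m) (b - _)).
apply: uniq_leq_size; first by rewrite filter_uniq // iota_uniq.
move=> j; rewrite mem_filter mem_index_iota mem_iota => /andP[].
case/crossesP=> x [y [/depth_e + + /depth_e]]; rewrite !inE; lia.
Qed.

(* Between its minimum and its maximum on [e], the depth can only change through
   sets [A i] crossed by [e], and [e] crosses exactly the levels in between. *)
Lemma sum_crosses_level_le_card e n :
  \sum_(0 <= j < n) crosses e (level j) <= #|[set i in S | crosses e (A i)]|.
Proof.
have [->|/set0Pn[z ze]] := eqVneq e set0.
  by rewrite big1 // => j _; rewrite /crosses set0I eqxx.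
have [x xe depth_x] := arg_maxnP depth ze.
have [y ye depth_y] := arg_minnP depth ze.
have depth_e : {in e, forall w, depth y <= depth w <= depth x}.
  by move=> w we; apply/andP; split; [apply: depth_y | apply: depth_x].
apply: leq_trans (sum_crosses_level_le_range 0 n depth_e) _.
rewrite maxn0 leq_subLR; apply: leq_trans (leq_card_setU _ _).
apply/subset_leq_card/subsetP=> i; rewrite !inE => /andP[iS xi]; rewrite iS /=.
by have [//|yi] := boolP (y \in A i); apply/crossesP; exists x, y.
Qed.

Definition met_privates e : {set I} := [set i in S | e :&: private i != set0].

Definition crosses_some_private e J : bool :=
  [exists i in J, crosses e (private i)].

Lemma sum_crosses_level_ge2_le_card e n : 1 < #|met_privates e| ->
  2 + \sum_(2 <= l < n) crosses e (level l)
    <= #|[set i in S | crosses e (A i)]|.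
Proof.
move=> met_gt1.
have met_crossed i : i \in S -> e :&: A i != set0 -> crosses e (A i).
  move=> iS ei; rewrite /crosses ei /=.
  have [j [jmet neq_ji]] : exists j, j \in met_privates e /\ j != i.
    have /card_gt1P[j [h [jmet hmet neq_jh]]] := met_gt1.
    by have [<-|neq_ji] := eqVneq j i; [exists h; rewrite eq_sym | exists j].
  have /setIdP[jS /set0Pn[x /setIP[xe /(privateP _ jS) eqj]]] := jmet.
  apply/set0Pn; exists x; rewrite inE xe inE; apply: contra neq_ji => xi.
  by rewrite eq_sym -in_set1 -eqj inE iS.
have card_crossed : 1 < #|[set i in S | crosses e (A i)]|.
  apply: leq_trans met_gt1 (subset_leq_card _); apply/subsetP=> i.
  rewrite !inE => /andP[iS ei]; rewrite iS met_crossed //.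
  exact: subset_neq0 (setIS _ (subsetDl _ _)) ei.
rewrite -leq_subRL //; apply: (@sum_crosses_level_le_range _ 0) => x xe /=.
apply/subset_leq_card/subsetP=> i; rewrite !inE => /andP[iS xi].
by rewrite iS met_crossed //; apply/set0Pn; exists x; apply/setIP.
Qed.

Lemma crosses_some_private_le_level e J :
  J \subset S -> #|met_privates e| <= 1 ->
  crosses_some_private e J <= crosses e (level 0) + crosses e (level 1).
Proof.
move=> /subsetP sJS /card_le1_eqP met_le1.
have [/exists_inP[i /sJS iS]|//] := boolP (crosses_some_private e J).
case/crossesP=> x [y [xe xi ye yi]].
have depth_x : depth x = 1 by rewrite /depth (privateP _ iS xi) cards1.
case: (ltngtP (depth y) 1) => [depth_y|depth_y|/eqP/cards1P[j eqj]].
- have -> // : crosses e (level 0).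
  by apply/crossesP; exists x, y; rewrite !inE depth_x -leqNgt.
- have -> : crosses e (level 1); last exact: leq_addl.
  by apply/crossesP; exists y, x; rewrite !inE depth_x.
- have /setIdP[jS yj] : j \in [set j in S | y \in A j] by rewrite eqj set11.
  have yPj : y \in private j by apply/(privateP _ jS).
  have eq_ji : j = i.
    by apply: met_le1; rewrite inE ?iS ?jS; apply/set0Pn;
      [exists x | exists y]; apply/setIP.
  by rewrite -eq_ji yPj in yi.
Qed.

Lemma crosses_some_private_disjoint e J K : J \subset S -> K \subset S ->
  [disjoint J & K] -> #|met_privates e| <= 1 ->
  ~~ (crosses_some_private e J && crosses_some_private e K).
Proof.
move=> /subsetP sJS /subsetP sKS disjJK /card_le1_eqP met_le1.
apply/negP=> /andP[/exists_inP[i iJ /andP[ei _]] /exists_inP[j jK /andP[ej _]]].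
have eq_ij : i = j by apply: met_le1; rewrite inE ?(sJS i) ?(sKS j).
by rewrite -eq_ij (disjointFr disjJK iJ) in jK.
Qed.

Lemma crosses_some_private_two_le e J K n : J \subset S -> K \subset S ->
  [disjoint J & K] ->
  crosses_some_private e J + crosses_some_private e K
    + \sum_(2 <= l < n.+2) crosses e (level l)
  <= #|[set i in S | crosses e (A i)]|.
Proof.
move=> sJS sKS disjJK; have [met_le1|met_gt1] := leqP #|met_privates e| 1.
  apply: leq_trans (sum_crosses_level_le_card e n.+2).
  rewrite [leqRHS]big_ltn // [X in _ <= _ + X]big_ltn // addnA leq_add2r.
  have := crosses_some_private_disjoint sJS sKS disjJK met_le1.
  have := crosses_some_private_le_level sJS met_le1.
  have := crosses_some_private_le_level sKS met_le1.
  by do 2!case: crosses_some_private.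
apply: leq_trans (sum_crosses_level_ge2_le_card n.+2 met_gt1).
by rewrite leq_add2r; do 2!case: crosses_some_private.
Qed.

Definition private_partition J : seq {set V} := add_remainder private J.

Lemma private_kpartition J : J \subset S ->
  {in S, forall i, private i != set0} -> level 1 != set0 ->
  is_kpartition #|J|.+1 (private_partition J).
Proof.
move=> /subsetP sJS ne_private /set0Pn[x x1]; apply: add_remainder_kpartition.
- by move=> i /sJS; apply: ne_private.
- by move=> i j /sJS iS /sJS jS; apply: private_disjoint.
- apply: contraTneq (in_setT x) => <-; apply/bigcupP => -[i _].
  by rewrite in_setD x1.
Qed.

Lemma pcost_private_partitions E J K n : J \subset S -> K \subset S ->
  [disjoint J & K] -> is_partition (private_partition J) ->
  is_partition (private_partition K) ->
  pcost E (private_partition J) + pcost E (private_partition K)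
    + \sum_(2 <= l < n.+2) dcut E (level l) <= \sum_(i in S) dcut E (A i).
Proof.
move=> sJS sKS disjJK partJ partK.
rewrite !pcost_add_remainder // !count_sum_nat.
under [X in _ + X]eq_bigr do rewrite dcutE.
under [leqRHS]eq_bigr do rewrite dcutE.
rewrite [X in _ + X]exchange_big [leqRHS]exchange_big -!big_split.
apply: leq_sum => e _ /=; rewrite sum_nat_pred_card.
exact: crosses_some_private_two_le.
Qed.

Lemma exists_cheap_kpartition E k D :
  0 < k -> k.*2 <= #|S| ->
  {in S, forall i, private i != set0} -> level 1 != set0 ->
  {in S, forall i, dcut E (A i) < D} ->
  (forall l, 1 < l < #|S| -> D <= dcut E (level l)) ->
  exists2 Q, is_kpartition k.+1 Q & pcost E Q < D.
Proof.
move=> k_gt0 le_kS ne_private ne_level dcutA dcut_level.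
have [|J [_ sJS cardJ]] := @exists_set_between I set0 S k (sub0set _).
  by rewrite cards0; lia.
have [|K [_ sK cardK]] := @exists_set_between I set0 (S :\: J) k (sub0set _).
  by rewrite cards0 cardsDS // cardJ; lia.
have /subsetDP[sKS disjKJ] := sK.
have partJ := private_kpartition sJS ne_private ne_level.
have partK := private_kpartition sKS ne_private ne_level.
rewrite cardJ in partJ; rewrite cardK in partK.
have disjJK : [disjoint J & K] by rewrite disjoint_sym.
have := pcost_private_partitions E (#|S| - 2) sJS sKS disjJK partJ.2 partK.2.
have -> : (#|S| - 2).+2 = #|S| by lia.
have : (#|S| - 2) * D <= \sum_(2 <= l < #|S|) dcut E (level l).
  rewrite -sum_nat_const_nat big_nat [leqRHS]big_nat.
  by apply: leq_sum => l; apply: dcut_level.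
have : \sum_(i in S) (dcut E (A i)).+1 <= #|S| * D.
  by rewrite -sum_nat_const; apply: leq_sum.
under eq_bigr do rewrite -addn1.
rewrite big_split /= sum_nat_const muln1 => le_sum ge_levels le_pcosts.
have [cheapJ|ge_J] := ltnP (pcost E (private_partition J)) D.
  by exists (private_partition J).
exists (private_partition K) => //.
have : #|S| * D = (#|S| - 2) * D + 2 * D by rewrite -mulnDl subnK //; lia.
by lia.
Qed.

End Levels.

(* The summand [U \proper X] makes the inequality strict for larger cuts. *)
Definition source_maximal E T U S : bool :=
  [&& S \subset U, U \subset ~: T
    & [forall X : {set V}, (S \subset X) && (X \subset ~: T) ==>
         (dcut E U + (U \proper X) <= dcut E X)]].

Lemma source_maximalP E T U S :
  reflect (is_source_maximal_min_terminal_cut E S T U) (source_maximal E T U S).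
Proof.
apply: (iffP and3P) => [[sSU sUT /forallP le_dcut]|].
  split=> [|[X [[[sSX sXT] minX] prUX]]].
    split=> // X [sSX sXT]; have := le_dcut X; rewrite sSX sXT /=.
    exact: leq_trans (leq_addr _ _).
  have := le_dcut X; rewrite sSX sXT prUX addn1 /=.
  by rewrite ltnNge minX.
case=> [[[sSU sUT] minU] maxU]; split=> //.
apply/forallP=> X; apply/implyP=> /andP[sSX sXT].
have [prUX|_] := boolP (U \proper X); last by rewrite addn0 minU.
rewrite addn1 ltnNge; apply/negP => le_XU; apply: maxU; exists X; split=> //.
by split=> // Y cutY; apply: leq_trans le_XU (minU Y cutY).
Qed.

Lemma source_maximal_supset E T U S S' : source_maximal E T U S ->
  S \subset S' -> S' \subset U -> source_maximal E T U S'.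
Proof.
case/and3P=> _ sUT /forallP le_dcut sSS' sS'U; apply/and3P; split=> //.
apply/forallP=> X; apply/implyP=> /andP[sS'X sXT].
by have := le_dcut X; rewrite (subset_trans sSS') // sXT.
Qed.

Lemma source_maximal_dcut_le E T U S X : source_maximal E T U S ->
  S \subset X -> X \subset ~: T -> dcut E U <= dcut E X.
Proof. by case/source_maximalP=> [[_ minU] _] sSX sXT; apply: minU. Qed.

Lemma minimal_source_dcut_lt E T U S u :
  minset (source_maximal E T U) S -> u \in S ->
  exists X,
    [/\ S :\ u \subset X, X \subset U, u \notin X & dcut E X < dcut E U].
Proof.
case/minsetP=> maxS minS uS; have /and3P[sSU sUT /forallP le_dcut] := maxS.
have : ~~ source_maximal E T U (S :\ u).
  apply/negP=> /minS/(_ (subD1set _ _))/setP/(_ u).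
  by rewrite !inE eqxx uS.
rewrite /source_maximal (subset_trans (subD1set _ _) sSU) sUT /=.
case/forallPn=> X; rewrite negb_imply -ltnNge => /andP[/andP[sSuX sXT] ltX].
have uX : u \notin X.
  apply: contraL ltX => uX; rewrite -leqNgt; have := le_dcut X.
  by rewrite sXT andbT -{1}(setD1K uS) subUset sub1set uX sSuX.
have not_prUX : ~~ (U \proper X).
  by apply: contra uX => /proper_sub/subsetP; apply; apply: (subsetP sSU).
rewrite (negPf not_prUX) addn0 in ltX.
exists (X :&: U); split.
- by rewrite subsetI sSuX (subset_trans (subD1set _ _)).
- exact: subsetIr.
- by rewrite inE (negPf uX).
- have := dcut_submod E X U.
  suff : dcut E U <= dcut E (X :|: U) by lia.
  apply: (source_maximal_dcut_le maxS); last by rewrite subUset sXT.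
  exact: subset_trans sSU (subsetUr _ _).
Qed.

Lemma minimal_source_cuts E T U S :
  minset (source_maximal E T U) S ->
  exists F : V -> {set V}, forall u, u \in S ->
    [/\ S :\ u \subset F u, F u \subset U, u \notin F u
      & dcut E (F u) < dcut E U].
Proof.
move=> minS; have cut u : exists X, u \in S ->
    [/\ S :\ u \subset X, X \subset U, u \notin X & dcut E X < dcut E U].
  have [/(minimal_source_dcut_lt minS)[X cutX]|_] := boolP (u \in S).
    by exists X.
  by exists set0.
exact: fin_all_exists cut.
Qed.

Lemma minimal_source_cheap_kpartition E k T U S :
  0 < k -> U != setT -> minset (source_maximal E T U) S -> k.*2 <= #|S| ->
  exists2 Q, is_kpartition k.+1 Q & pcost E Q < dcut E U.
Proof.
move=> k_gt0 neUT minS le_kS.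
have /minsetP[maxS _] := minS; have /and3P[_ sUT _] := maxS.
have [F cutF] := minimal_source_cuts minS.
pose A u := ~: F u.
have coverS u : u \in S -> [set v in S | u \in A v] = [set u].
  move=> uS; apply/setP=> v; rewrite !inE; have [vS|vS] /= := boolP (v \in S).
    have [/subsetP sSvF _ vF _] := cutF v vS.
    have [<-|neq_vu] := eqVneq v u; first by rewrite vF.
    by rewrite sSvF // !inE eq_sym neq_vu.
  by apply/esym; apply: contraNF vS => /eqP ->.
have sUc_level l : l < #|S| -> ~: U \subset level A S l.
  by apply: subset_level => u /cutF[_ sFU _ _]; rewrite setCS.
apply: (exists_cheap_kpartition (A := A) k_gt0 le_kS).
- by move=> u uS; apply/set0Pn; exists u; apply/privateP => //; apply: coverS.
- apply: subset_neq0 (sUc_level 1 _) _; first by lia.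
  by rewrite -(inj_eq (@setC_inj V)) setCK setC0.
- by move=> u /cutF[_ _ _]; rewrite dcutC.
- move=> l /andP[l_gt1 l_lt]; rewrite -[leqRHS]dcutC.
  apply: (source_maximal_dcut_le maxS).
    apply/subsetP=> u uS; rewrite !inE /depth (coverS u uS) cards1; lia.
  by apply: subset_trans sUT; rewrite -setCS setCK sUc_level.
Qed.

Lemma maximal_min_kpartition_source_maximal E k A P T :
  is_maximal_min_kpartition E k (A :: P) -> T \subset ~: A ->
  {in P, forall B, T :&: B != set0} -> source_maximal E T A A.
Proof.
move=> maxP sTA neTP; rewrite /source_maximal subxx /=.
have sAT : A \subset ~: T by rewrite -(setCK A) setCS.
rewrite sAT /=; apply/forallP=> X; apply/implyP=> /andP[sAX sXT].
have [prAX|] := boolP (A \proper X); last first.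
  by rewrite properEneq sAX andbT negbK => /eqP ->; rewrite addn0.
rewrite addn1; apply: maximal_min_kpartition_dcut_lt maxP prAX _ => B BP.
apply: subset_neq0 (neTP B BP); rewrite setIC setDE setIS //.
by rewrite -(setCK T) setCS.
Qed.

End Hypergraph.

Theorem theorem1p2 (V : finType) (E : seq {set V}) (k : nat)
  (P : seq {set V}) :
  2 <= k ->
  is_maximal_min_kpartition E k P ->
  2 * k - 2 <= #|nth set0 P 0| ->
  forall T : {set V},
    T \subset ~: nth set0 P 0 ->
    (forall j, 1 <= j < k -> T :&: nth set0 P j != set0) ->
    exists S : {set V},
      [/\ S \subset nth set0 P 0, #|S| = 2 * k - 2 &
          is_source_maximal_min_terminal_cut E S T (nth set0 P 0)].
Proof.
case: k => [//|k] k_gt0 maxP le_kV1 T sTV1 neT.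
have [[[sizeP partP] minP] _] := maxP.
case: P sizeP => [//|U P] [sizeP] in partP minP maxP le_kV1 sTV1 neT *.
have neUT : U != setT.
  have /set0Pn[x /setIP[xT _]] := neT 1 k_gt0.
  by apply: contraTneq (subsetP sTV1 _ xT) => /= ->; rewrite !inE.
have maxU : source_maximal E T U U.
  apply: (maximal_min_kpartition_source_maximal maxP) => // B.
  by case/(nthP set0)=> j ltj <-; apply: (neT j.+1); rewrite ltnS -sizeP.
have [S minS sSU] := minset_exists maxU.
have ltS : #|S| < k.*2.
  rewrite ltnNge; apply/negP => le_kS.
  have [Q kQ ltQ] := minimal_source_cheap_kpartition k_gt0 neUT minS le_kS.
  have := leq_trans ltQ (dcut_le_pcost E partP (mem_head _ _)).
  by rewrite ltnNge minP.
have [|S' [sSS' sS'U cardS']] := exists_set_between (m := 2 * k.+1 - 2) sSU.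
  by rewrite le_kV1; lia.
exists S'; split=> //; apply/source_maximalP.
have /minsetP[maxS _] := minS.
exact: source_maximal_supset maxS sSS' sS'U.
Qed.
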